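(* Let $n\ge 3$, let $A=(a_{ij})_{1\le i,j\le n}$ be a real $n\times n$ matrix, let $\pi$ be uniformly distributed over the symmetric group $S_n$, and let $Y=\sum_{i=1}^n a_{i\pi(i)}$. Set $a_{i\cdot}=\frac1n\sum_{j=1}^n a_{ij}$, $a_{\cdot j}=\frac1n\sum_{i=1}^n a_{ij}$, $a_{\cdot\cdot}=\frac1{n^2}\sum_{i,j=1}^n a_{ij}$, $\mu_A=na_{\cdot\cdot}$ (the mean of $Y$), $$\sigma_A^2=\frac{1}{n-1}\sum_{1\le i,j\le n}(a_{ij}-a_{i\cdot}-a_{\cdot j}+a_{\cdot\cdot})^2$$ (the variance of $Y$), assumed nonzero, $\|a\|=\max_{1\le i,j\le n}|a_{ij}-a_{i\cdot}|$ and $c=8\|a\|$. Then for every $t\ge 0$, $$\max\{\mathbb{P}(Y-\mu_A\ge t),\mathbb{P}(Y-\mu_A\le -t)\}\le \exp\left(-\frac{t^2}{2(\sigma_A^2+ct)}\right)\quad\text{and}\quad \max\{\mathbb{P}(Y-\mu_A\ge t),\mathbb{P}(Y-\mu_A\le -t)\}\le \exp\left(-\frac{t^2}{10\sigma_A^2/3+ct}\right),$$ and for every $t>e$, $$\max\{\mathbb{P}(Y-\mu_A\ge t),\mathbb{P}(Y-\mu_A\le -t)\}\le \exp\left(-\frac{t}{c}\left(\log t-\log\log t-\frac{\sigma_A^2}{c}\right)\right)\le\exp\left(-\frac{t}{2c}\left(\log t-\frac{2\sigma_A^2}{c}\right)\right).$$ *)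

(* Defs.v *)
From mathcomp Require Import all_boot perm.
From Stdlib Require Import Reals.
Set Implicit Arguments. Unset Strict Implicit. Unset Printing Implicit Defensive.

Local Open Scope R_scope.

Definition rsum (n : nat) (F : 'I_n -> R) : R := \big[Rplus/0]_(i < n) F i.

Section Defs.
Variables (n : nat) (A : 'I_n -> 'I_n -> R).

Definition Ystat (s : 'S_n) : R := rsum (fun i => A i (s i)).

Definition row_avg (i : 'I_n) : R := / INR n * rsum (fun j => A i j).
Definition col_avg (j : 'I_n) : R := / INR n * rsum (fun i => A i j).
Definition tot_avg : R := / (INR n * INR n) * rsum (fun i => rsum (fun j => A i j)).
Definition muA : R := INR n * tot_avg.
Definition sigma2A : R :=
  / (INR n - 1) * rsum (fun i => rsum (fun j =>
      (A i j - row_avg i - col_avg j + tot_avg) ^ 2)).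
Definition normA : R :=
  \big[Rmax/0]_(i < n) \big[Rmax/0]_(j < n) Rabs (A i j - row_avg i).
Definition cA : R := 8 * normA.

Definition probS (P : 'S_n -> bool) : R :=
  INR #|[set s : 'S_n | P s]| / INR #|[set: 'S_n]|.

Definition Rleb (x y : R) : bool := if Rle_dec x y then true else false.

Definition P_upper (t : R) : R := probS (fun s => Rleb t (Ystat s - muA)).
Definition P_lower (t : R) : R := probS (fun s => Rleb (Ystat s - muA) (- t)).
Definition P_tail (t : R) : R := Rmax (P_upper t) (P_lower t).
End Defs.

(* Main.v *)
(** Write W = Y - mu_A and let W' be W after a uniformly random transposition
of the rows.  Since E[W' - W | pi] is proportional to -W, exchangeability and
convexity of exp bound E[W e^(uW)] by a multiple of E[(W' - W)^2 e^(uW)].  Here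
(W' - W)^2 depends only on the two swapped rows and their images, and
conditioning on two values of pi changes E[e^(uW)] by a factor at most e^(cu),
because composing with two transpositions moves W by at most 8 ||a|| = c.
Averaging (W' - W)^2 gives m'(u) <= sigma^2 u e^(cu) m(u) for the moment
generating function m, the inequality that the zero-bias coupling would give.
Integrating and applying Markov's inequality with u = t / (sigma^2 + c t),
u = 2 t / (10 sigma^2 / 3 + c t) and u = (log t - log log t) / c yields the three
bounds; the lower tail follows by replacing A with -A. *)

Require Import Defs.
From HB Require Import structures.
From mathcomp Require Import all_boot fingroup perm.
From Stdlib Require Import Reals Lra.
From Coquelicot Require Import Coquelicot.
Local Open Scope R_scope.

(** * Finite sums of real numbers *)

HB.instance Definition _ :=
  Monoid.isComLaw.Build R 0 Rplus (fun x y z => esym (Rplus_assoc x y z))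
    Rplus_comm Rplus_0_l.
HB.instance Definition _ := Monoid.isMulLaw.Build R 0 Rmult Rmult_0_l Rmult_0_r.
HB.instance Definition _ :=
  Monoid.isAddLaw.Build R Rmult Rplus Rmult_plus_distr_r Rmult_plus_distr_l.

Local Notation "\sum_ i F" := (\big[Rplus/0]_i F) : R_scope.
Local Notation "\sum_ ( i | P ) F" := (\big[Rplus/0]_(i | P%B) F) : R_scope.
Local Notation "\sum_ ( i : t ) F" :=
  (\big[Rplus/0]_(i : t) F) (only parsing) : R_scope.
Local Notation "\sum_ ( i : t | P ) F" :=
  (\big[Rplus/0]_(i : t | P%B) F) (only parsing) : R_scope.

Lemma Rsum_le (I : finType) (P : pred I) (F G : I -> R) :
  (forall i, P i -> F i <= G i) -> \sum_(i | P i) F i <= \sum_(i | P i) G i.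
Proof.
move=> h; elim/big_ind2: _ => //; [exact: Rle_refl | by move=> *; lra].
Qed.

Lemma Rsum_add (I : finType) (F G : I -> R) :
  \sum_i (F i + G i) = \sum_i F i + \sum_i G i.
Proof. exact: big_split. Qed.

Lemma Rsum_opp (I : finType) (F : I -> R) : \sum_i - F i = - \sum_i F i.
Proof. by rewrite (big_morph Ropp Ropp_plus_distr Ropp_0). Qed.

Lemma Rsum_sub (I : finType) (F G : I -> R) :
  \sum_i (F i - G i) = \sum_i F i - \sum_i G i.
Proof. by rewrite /Rminus -Rsum_opp -Rsum_add. Qed.

Lemma Rsum_const (I : finType) (P : pred I) (x : R) :
  \sum_(i | P i) x = INR #|P| * x.
Proof.
rewrite big_const; elim: #|P| => [|m IH]; first by rewrite /=; ring.
by rewrite iterS IH S_INR; ring.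
Qed.

Lemma Rmult_sumr (I : finType) (P : pred I) (x : R) (F : I -> R) :
  x * \sum_(i | P i) F i = \sum_(i | P i) x * F i.
Proof. exact: big_distrr. Qed.

Lemma Rmult_suml (I : finType) (P : pred I) (x : R) (F : I -> R) :
  (\sum_(i | P i) F i) * x = \sum_(i | P i) F i * x.
Proof. exact: big_distrl. Qed.

(** * Monotonicity and convexity estimates for the exponential *)

Lemma nondecreasing_from_0 (f df : R -> R) (x : R) :
  (forall y, 0 <= y <= x -> is_derive f y (df y)) ->
  (forall y, 0 <= y <= x -> 0 <= df y) -> 0 <= x -> f 0 <= f x.
Proof.
move=> fD df0 x0; case: (Req_dec x 0) => [->|xN0]; first exact: Rle_refl.
have [|y Hy|z [Hz1 Hz2]] := MVT_cor2 f df 0 x; first lra.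
  exact/is_derive_Reals/fD.
have := df0 z ltac:(lra); nra.
Qed.

Lemma exp_nondecreasing (x y : R) : x <= y -> exp x <= exp y.
Proof. by case=> [/exp_increasing|->]; lra. Qed.

Lemma exp_mul_one_sub_le (x : R) : (1 - x) * exp x <= 1.
Proof.
have := exp_ineq1_le (- x); rewrite exp_Ropp => h; have e0 := exp_pos x.
have : (1 - x) * exp x <= / exp x * exp x by apply: Rmult_le_compat_r; lra.
by rewrite Rinv_l; lra.
Qed.

(* The trapezoid half of Hermite-Hadamard for the convex function exp. *)
Lemma exp_sub_le (x y : R) :
  (x - y) * (exp x - exp y) <= (x - y) ^ 2 * ((exp x + exp y) / 2).
Proof.
(* Translation and division by x - y reduce the claim to this one. The difference of its two sides
   has derivative (1 + (h - 1) e^h) / 2, nonnegative by [exp_mul_one_sub_le]. *)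
have H (h : R) : 0 <= h -> exp h - 1 <= h * ((exp h + 1) / 2).
  move=> h0; pose f u := u * ((exp u + 1) / 2) - exp u + 1.
  have : f 0 <= f h.
    apply: (@nondecreasing_from_0 f (fun u => (1 + (u - 1) * exp u) / 2)) => //.
      by move=> u _; rewrite /f; auto_derive => //; field.
    by move=> u _; have := exp_mul_one_sub_le u; lra.
  rewrite /f exp_0; lra.
have K (u v : R) : v <= u -> (u - v) * (exp u - exp v) <=
    (u - v) ^ 2 * ((exp u + exp v) / 2).
  move=> uv; have := H (u - v) ltac:(lra).
  have -> : exp u = exp (u - v) * exp v by rewrite -exp_plus; f_equal; ring.
  move: (exp (u - v)) (exp_pos v) => e; move: (exp v) => w w0 He.
  have -> : (u - v) ^ 2 * ((e * w + w) / 2) =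
      (u - v) * w * ((u - v) * ((e + 1) / 2)) by field.
  have -> : (u - v) * (e * w - w) = (u - v) * w * (e - 1) by ring.
  apply: Rmult_le_compat_l => //; nra.
case: (Rle_dec y x) => xy; first exact: K.
by have := K y x ltac:(lra); nra.
Qed.

(** * Squared differences, transpositions and the permutation statistic *)

Lemma sum_sq_diff (n : nat) (y : 'I_n -> R) : \sum_i y i = 0 ->
  \sum_i \sum_j (y i - y j) ^ 2 = 2 * INR n * \sum_i y i ^ 2.
Proof.
move=> y0.
have inner i : \sum_j (y i - y j) ^ 2 = INR n * y i ^ 2 + \sum_j y j ^ 2.
  transitivity (\sum_j (y i ^ 2 + y j ^ 2 + (- 2 * y i) * y j)).
    by apply: eq_bigr => j _; ring.
  rewrite !Rsum_add -(@Rmult_sumr _ _ (-2 * y i)) y0 Rsum_const card_ord.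
  by ring.
rewrite (eq_bigr _ (fun i _ => inner i)) Rsum_add -(@Rmult_sumr _ _ (INR n)).
by rewrite Rsum_const card_ord; ring.
Qed.

(** Needing only two transpositions is what produces the constant 2 d in [cond_mgf_le]. *)
Lemma tperm_pair (T : finType) (i j k l : T) : i != j -> k != l ->
  (* The second transposition starts where the first one sends [j]; this is not [k] because [j]
     differs from [i], so the image of [i] stays put. *)
  exists x y z w : T,
    (tperm x y * tperm z w)%g i = k /\ (tperm x y * tperm z w)%g j = l.
Proof.
move=> ij kl; exists i, k, (tperm i k j), l.
rewrite !permM !tpermL; split=> //; apply: tpermD; last by rewrite eq_sym.
by rewrite -{2}(tpermL i k) (inj_eq perm_inj) eq_sym.
Qed.

(** Increment of the statistic when rows [i] and [j], with images [k] and [l], exchange their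
    images. *)
Definition swap_diff {n : nat} (B : 'I_n -> 'I_n -> R) (i j k l : 'I_n) : R :=
  B i l + B j k - B i k - B j l.

Lemma Ystat_tperm_mul (n : nat) (B : 'I_n -> 'I_n -> R) (i j : 'I_n) (s : 'S_n) :
  Ystat B (tperm i j * s) = Ystat B s + swap_diff B i j (s i) (s j).
Proof.
rewrite /swap_diff; case: (eqVneq i j) => [->|ij].
  by rewrite tperm1 mul1g; ring.
have ji : j != i by rewrite eq_sym.
rewrite /Ystat /rsum !(bigD1 (P := xpredT) i) //=.
rewrite !(bigD1 (P := fun k => k != i) j) //=.
rewrite !permM tpermL tpermR.
rewrite (eq_bigr (fun k => B k (s k))); first ring.
by move=> k /andP[ki kj]; rewrite permM tpermD // eq_sym.
Qed.

(** By conjugation, transposing two values amounts to transposing the two rows that take them. *)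
Lemma Ystat_mul_tperm_le (n : nat) (B : 'I_n -> 'I_n -> R) (d : R)
    (hB : forall i j k l, swap_diff B i j k l <= d) (k l : 'I_n) (s : 'S_n) :
  Ystat B (s * tperm k l) <= Ystat B s + d.
Proof.
have -> : (s * tperm k l = tperm (s^-1 k) (s^-1 l) * s)%g.
  by rewrite -tpermJ conjgE invgK mulgA mulgKV.
rewrite Ystat_tperm_mul.
by have := hB (s^-1 k)%g (s^-1 l)%g (s (s^-1 k))%g (s (s^-1 l))%g; lra.
Qed.

(** * Comparison of conditional and unconditional moment generating functions *)

Definition mgfsum {n : nat} (B : 'I_n -> 'I_n -> R) (u : R) : R :=
  \sum_(s : 'S_n) exp (u * Ystat B s).

(* A bijection by two transpositions of values compares the two conditional
   moment generating functions; each transposition costs at most d. *)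
Lemma cond_mgf_le (n : nat) (B : 'I_n -> 'I_n -> R) (d u : R)
    (hB : forall i j k l, swap_diff B i j k l <= d) (u0 : 0 <= u)
    (i j k l k' l' : 'I_n) : k != l -> k' != l' ->
  \sum_(s : 'S_n | (s i == k) && (s j == l)) exp (u * Ystat B s) <=
  exp (u * (2 * d)) *
    \sum_(s : 'S_n | (s i == k') && (s j == l')) exp (u * Ystat B s).
Proof.
move=> kl kl'; have [x [y [z [w [Hk Hl]]]]] := @tperm_pair _ k' l' k l kl' kl.
rewrite (reindex_inj (mulIg (tperm x y * tperm z w)%g)) /= Rmult_sumr.
rewrite (eq_bigl (fun s : 'S_n => (s i == k') && (s j == l'))); last first.
  move=> s; rewrite !(permM s) -{1}Hk -{1}Hl.
  by rewrite !(inj_eq perm_inj).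
apply: Rsum_le => s _; rewrite -exp_plus mulgA.
have h1 := @Ystat_mul_tperm_le n B d hB z w (s * tperm x y)%g.
have h2 := @Ystat_mul_tperm_le n B d hB x y s.
apply: exp_nondecreasing; rewrite -Rmult_plus_distr_l.
apply: Rmult_le_compat_l => //; apply: Rle_trans h1 _.
apply: Rle_trans (Rplus_le_compat_r d _ _ h2) _; right; ring.
Qed.

(** The n (n - 1) possible images of the pair [(i, j)] partition the symmetric group; summing
    [cond_mgf_le] over all of them as target pairs gives the average. *)
Lemma cond_mgf_avg (n : nat) (B : 'I_n -> 'I_n -> R) (d u : R)
    (hn : leq 2 n) (hB : forall i j k l, swap_diff B i j k l <= d) (u0 : 0 <= u)
    (i j k l : 'I_n) : i != j -> k != l ->
  \sum_(s : 'S_n | (s i == k) && (s j == l)) exp (u * Ystat B s) <=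
  exp (u * (2 * d)) * mgfsum B u / (INR n * (INR n - 1)).
Proof.
move=> ij kl.
have n2 : 2 <= INR n by apply: (le_INR 2); apply/leP.
set L := \sum_(s : _ | _) _.
have -> : mgfsum B u = \sum_(k' : 'I_n) \sum_(l' : 'I_n | l' != k')
    \sum_(s : 'S_n | (s i == k') && (s j == l')) exp (u * Ystat B s).
  rewrite /mgfsum (partition_big (fun s : 'S_n => s i) xpredT) //=.
  apply: eq_bigr => k' _.
  rewrite (partition_big (fun s : 'S_n => s j) (fun l' => l' != k')) //.
  by move=> s /eqP <-; rewrite (inj_eq perm_inj) eq_sym.
have H : INR n * ((INR n - 1) * L) <= exp (u * (2 * d)) *
    \sum_(k' : 'I_n) \sum_(l' : 'I_n | l' != k')
    \sum_(s : 'S_n | (s i == k') && (s j == l')) exp (u * Ystat B s).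
  have -> : INR n * ((INR n - 1) * L) =
      \sum_(k' : 'I_n) \sum_(l' : 'I_n | l' != k') L.
    rewrite (eq_bigr (fun=> (INR n - 1) * L)); last first.
      move=> k' _; rewrite Rsum_const (cardC1 k') card_ord.
      by case: {+}n hn => // m _; rewrite -pred_Sn S_INR; ring.
    by rewrite Rsum_const card_ord.
  rewrite Rmult_sumr; apply: Rsum_le => k' _.
  rewrite Rmult_sumr; apply: Rsum_le => l' lk.
  by apply: cond_mgf_le => //; rewrite eq_sym.
apply/Rle_div_r; first nra.
have -> : L * (INR n * (INR n - 1)) = INR n * ((INR n - 1) * L) by ring.
exact: H.
Qed.

(** * Random transpositions: drift, quadratic form and the differential inequality *)

Lemma sum_swap_diff_sq (n : nat) (B : 'I_n -> 'I_n -> R)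
    (rows : forall i, \sum_j B i j = 0) (cols : forall j, \sum_i B i j = 0) :
  \sum_i \sum_j \sum_k \sum_l swap_diff B i j k l ^ 2 =
  4 * INR n ^ 2 * \sum_i \sum_j B i j ^ 2.
Proof.
(* For fixed rows, [swap_diff] is a difference of two entries of the vector [B i - B j], whose sum
   is zero. [sum_sq_diff] is used again below over pairs of rows, where zero column sums are
   needed. *)
have inner i j : \sum_k \sum_l swap_diff B i j k l ^ 2 =
    2 * INR n * \sum_k (B i k - B j k) ^ 2.
  rewrite -sum_sq_diff; last by rewrite Rsum_sub !rows; ring.
  by apply: eq_bigr => k _; apply: eq_bigr => l _; rewrite /swap_diff; ring.
transitivity (\sum_i \sum_j 2 * INR n * \sum_k (B i k - B j k) ^ 2).
  by apply: eq_bigr => i _; apply: eq_bigr => j _.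
transitivity (2 * INR n * \sum_k \sum_i \sum_j (B i k - B j k) ^ 2).
  rewrite [X in _ = _ * X]exchange_big Rmult_sumr; apply: eq_bigr => i _.
  by rewrite [X in _ = _ * X]exchange_big Rmult_sumr; apply: eq_bigr => j _.
rewrite (eq_bigr (fun k => 2 * INR n * \sum_i B i k ^ 2)); last first.
  by move=> k _; apply: sum_sq_diff.
by rewrite -Rmult_sumr exchange_big -Rmult_assoc; congr (_ * _); ring.
Qed.

(** The regression property of the exchangeable pair: the cross terms sum to full row and column
    sums, which vanish. *)
Lemma Ystat_drift (n : nat) (B : 'I_n -> 'I_n -> R)
    (rows : forall i, \sum_j B i j = 0) (cols : forall j, \sum_i B i j = 0)
    (s : 'S_n) :
  \sum_i \sum_j (Ystat B s - Ystat B (tperm i j * s)) =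
  2 * INR n * Ystat B s.
Proof.
have YE : \sum_i B i (s i) = Ystat B s by [].
have rowE i : \sum_j B i (s j) = 0.
  by rewrite -[RHS](rows i) [RHS](reindex_inj (@perm_inj _ s)).
have inner i : \sum_j (Ystat B s - Ystat B (tperm i j * s)) =
    INR n * B i (s i) + Ystat B s.
  transitivity (\sum_j (B i (s i) + B j (s j) - (B i (s j) + B j (s i)))).
    by apply: eq_bigr => j _; rewrite Ystat_tperm_mul /swap_diff; ring.
  rewrite Rsum_sub !Rsum_add cols YE rowE Rsum_const card_ord; ring.
rewrite (eq_bigr _ (fun i _ => inner i)) Rsum_add -(@Rmult_sumr _ _ (INR n)).
by rewrite Rsum_const card_ord YE; ring.
Qed.

(** Left multiplication by [tperm i j] is an involution of ['S_n], so both sums can be symmetrised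
    under it ([halve]); the symmetrised terms are compared one by one by [exp_sub_le]. *)
Lemma swap_dirichlet_le (n : nat) (B : 'I_n -> 'I_n -> R) (u : R) (u0 : 0 <= u)
    (i j : 'I_n) :
  \sum_(s : 'S_n) (Ystat B s - Ystat B (tperm i j * s)) * exp (u * Ystat B s) <=
  u / 2 * \sum_(s : 'S_n)
            swap_diff B i j (s i) (s j) ^ 2 * exp (u * Ystat B s).
Proof.
pose Y := Ystat B; pose t := tperm i j; pose E s := exp (u * Y s).
have swapE (F : 'S_n -> R) : \sum_s F s = \sum_s F (t * s)%g.
  exact: (reindex_inj (mulgI t)).
have tt s : (t * (t * s))%g = s by rewrite mulgA tperm2 mul1g.
have halve (F G : 'S_n -> R) : (forall s, F s + F (t * s)%g = 2 * G s) ->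
    \sum_s F s = \sum_s G s.
  move=> FG; have : \sum_s F s + \sum_s F (t * s)%g = 2 * \sum_s G s.
    by rewrite -Rsum_add Rmult_sumr; apply: eq_bigr => s _.
  rewrite -swapE; lra.
rewrite (halve (fun s => (Y s - Y (t * s)%g) * E s)
  (fun s => / 2 * ((Y s - Y (t * s)%g) * (E s - E (t * s)%g))));
  last by move=> s; rewrite tt -/(E _) -/(E _); field.
rewrite (halve (fun s => swap_diff B i j (s i) (s j) ^ 2 * E s)
  (fun s => (Y s - Y (t * s)%g) ^ 2 * ((E s + E (t * s)%g) / 2))); last first.
  move=> s; have D (s' : 'S_n) : swap_diff B i j (s' i) (s' j) =
      Y (t * s')%g - Y s'.
    by rewrite /Y Ystat_tperm_mul; ring.
  by rewrite !D tt; field.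
rewrite Rmult_sumr; apply: Rsum_le => s _.
have -> : u / 2 = / 2 * u by field.
rewrite Rmult_assoc; apply: Rmult_le_compat_l; first lra.
case: (Req_dec u 0) => [uz|uN0].
  by rewrite /E uz !Rmult_0_l exp_0; lra.
have := exp_sub_le (u * Y s) (u * Y (t * s)%g); rewrite -!/(E _).
move: (E s) (E (t * s)%g) => e f.
set v := Y s - Y _ => H; apply: (Rmult_le_reg_l u); first lra.
have -> : u * (v * (e - f)) = (u * Y s - u * Y (t * s)%g) * (e - f).
  by rewrite /v; ring.
apply: Rle_trans H _; right; rewrite /v; ring.
Qed.

(** After multiplication by 2 n, [Ystat_drift] turns the left side into a sum over row pairs.
    [swap_dirichlet_le] makes it quadratic, and splitting by the images of the pair lets
    [cond_mgf_avg] replace each conditional sum by the common bound [K]. *)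
Lemma mgf_deriv_le (n : nat) (B : 'I_n -> 'I_n -> R) (d u : R) (hn : leq 2 n)
    (rows : forall i, \sum_j B i j = 0) (cols : forall j, \sum_i B i j = 0)
    (hB : forall i j k l, swap_diff B i j k l <= d) (u0 : 0 <= u) :
  \sum_(s : 'S_n) Ystat B s * exp (u * Ystat B s) <=
  (/ (INR n - 1) * \sum_i \sum_j B i j ^ 2) * u * exp (2 * d * u) * mgfsum B u.
Proof.
have n2 : 2 <= INR n by apply: (le_INR 2); apply/leP.
apply: (Rmult_le_reg_l (2 * INR n)); first lra.
rewrite [X in X <= _](_ : _ = \sum_i \sum_j \sum_(s : 'S_n)
    (Ystat B s - Ystat B (tperm i j * s)) * exp (u * Ystat B s)); last first.
  transitivity (\sum_(s : 'S_n) \sum_i \sum_j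
      (Ystat B s - Ystat B (tperm i j * s)) * exp (u * Ystat B s)).
    rewrite Rmult_sumr.
    apply: eq_bigr => s _; rewrite -Rmult_assoc -Ystat_drift // Rmult_suml.
    by apply: eq_bigr => i _; rewrite Rmult_suml.
  by rewrite exchange_big; apply: eq_bigr => i _; rewrite exchange_big.
set K := exp (u * (2 * d)) * mgfsum B u / (INR n * (INR n - 1)).
apply: (Rle_trans _ (\sum_i \sum_j u / 2 *
    \sum_k \sum_l swap_diff B i j k l ^ 2 * K)).
  apply: Rsum_le => i _; apply: Rsum_le => j _.
  apply: Rle_trans (@swap_dirichlet_le n B u u0 i j) _.
  apply: Rmult_le_compat_l; first lra.
  rewrite (partition_big (fun s : 'S_n => s i) xpredT) //=.
  apply: Rsum_le => k _.
  rewrite (partition_big (fun s : 'S_n => s j) xpredT) //=.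
  apply: Rsum_le => l _.
  rewrite (eq_bigr (fun s => swap_diff B i j k l ^ 2 * exp (u * Ystat B s)));
    last by move=> s /andP[/eqP -> /eqP ->].
  rewrite -Rmult_sumr.
  (* [cond_mgf_avg] needs distinct rows and distinct images; in the degenerate cases the coefficient
     is zero. *)
  case: (eqVneq i j) => [->|ij].
    have -> : swap_diff B j j k l = 0 by rewrite /swap_diff; ring.
    by right; ring.
  case: (eqVneq k l) => [->|kl].
    have -> : swap_diff B i j l l = 0 by rewrite /swap_diff; ring.
    by right; ring.
  by apply: Rmult_le_compat_l; [exact: pow2_ge_0 | exact: cond_mgf_avg].
right; transitivity (u / 2 * (4 * INR n ^ 2 * \sum_i \sum_j B i j ^ 2) * K).
  rewrite -sum_swap_diff_sq // Rmult_sumr Rmult_suml.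
  apply: eq_bigr => i _; rewrite Rmult_sumr Rmult_suml.
  apply: eq_bigr => j _; rewrite Rmult_assoc Rmult_suml; congr (_ * _).
  by apply: eq_bigr => k _; rewrite Rmult_suml.
have -> : 2 * d * u = u * (2 * d) by ring.
rewrite /K; field; lra.
Qed.

(** * Integration of the differential inequality and Markov's inequality *)

Lemma is_derive_Rsum (I : finType) (F : I -> R -> R) (dF : I -> R) (x : R) :
  (forall i, is_derive (F i) x (dF i)) ->
  is_derive (fun y => \sum_i F i y) x (\sum_i dF i).
Proof.
move=> FD; elim: (index_enum I) => [|i r IH].
  rewrite big_nil; apply: (is_derive_ext (fun=> 0)).
    by move=> y; rewrite big_nil.
  exact: is_derive_const.
rewrite big_cons.
apply: (is_derive_ext (fun y => F i y + \big[Rplus/0]_(j <- r) F j y)).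
  by move=> y; rewrite big_cons.
exact: is_derive_plus.
Qed.

(* phi (c u) / c ^ 2 is the primitive of u exp (c u) vanishing at 0. *)
Definition phi (x : R) : R := exp x * (x - 1) + 1.

Lemma is_derive_phi (x : R) : is_derive phi x (x * exp x).
Proof. by rewrite /phi; auto_derive => //; ring. Qed.

(** A Gronwall argument: [hM] bounds the logarithmic derivative by v w e^(cw), whose primitive is v
    / c^2 times [phi (c * w)], so the quotient by the claimed exponential is nonincreasing. At 0 the
    sum counts the permutations. *)
Lemma mgfsum_le (n : nat) (B : 'I_n -> 'I_n -> R) (v c u : R) (c0 : 0 < c)
    (u0 : 0 <= u)
    (hM : forall w, 0 <= w -> \sum_(s : 'S_n) Ystat B s * exp (w * Ystat B s) <=
      v * w * exp (c * w) * mgfsum B w) :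
  mgfsum B u <= INR #|[set: 'S_n]| * exp (v / c ^ 2 * phi (c * u)).
Proof.
pose dM w := \sum_(s : 'S_n) Ystat B s * exp (w * Ystat B s).
have MD w : is_derive (mgfsum B) w (dM w).
  by apply: is_derive_Rsum => s; auto_derive => //; ring.
set k := v / c ^ 2.
have vE : v = k * c ^ 2 by rewrite /k; field; lra.
pose f w := - (mgfsum B w * exp (- (k * phi (c * w)))).
have : f 0 <= f u.
  apply: (nondecreasing_from_0 f (fun w =>
    (v * w * exp (c * w) * mgfsum B w - dM w) *
    exp (- (k * phi (c * w))))) => // w [w0 _].
    rewrite /f; auto_derive.
      by do!split; [exists (dM w) |
        exists (c * w * exp (c * w)); exact: is_derive_phi].
    have -> : Derive [eta mgfsum B] w = dM w by exact: is_derive_unique.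
    have -> : Derive [eta phi] (c * w) = c * w * exp (c * w).
      exact/is_derive_unique/is_derive_phi.
    by rewrite vE; ring.
  by apply: Rmult_le_pos; [have := hM w w0; rewrite -/(dM w); lra
    | exact/Rlt_le/exp_pos].
have -> : f 0 = - INR #|[set: 'S_n]|.
  rewrite /f /phi /mgfsum (eq_bigr (fun=> 1)); last first.
    by move=> s _; rewrite Rmult_0_l exp_0.
  rewrite Rsum_const cardsT Rmult_0_r exp_0.
  have -> : - (k * (1 * (0 - 1) + 1)) = 0 by ring.
  by rewrite exp_0 !Rmult_1_r; congr (- INR _); apply: eq_card.
rewrite /f exp_Ropp => H; set e := exp _ in H *.
have e0 : 0 < e by exact: exp_pos.
by apply/(Rle_div_l _ _ _ e0); rewrite /Rdiv; lra.
Qed.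

(** On the event each term of e^(-ut) [mgfsum B u] is at least 1; the other terms are nonnegative
    and dropped. *)
Lemma probS_le (n : nat) (B : 'I_n -> 'I_n -> R) (t u : R) : 0 <= u ->
  probS (fun s : 'S_n => Rleb t (Ystat B s)) <=
  exp (- u * t) * (mgfsum B u / INR #|[set: 'S_n]|).
Proof.
move=> u0; rewrite /probS /Rdiv -Rmult_assoc.
apply: Rmult_le_compat_r.
  apply/Rlt_le/Rinv_0_lt_compat/(lt_INR 0)/ltP.
  by rewrite cardsT; apply/card_gt0P; exists 1%g.
rewrite cardsE -[INR _]Rmult_1_r -Rsum_const /mgfsum Rmult_sumr.
rewrite [X in _ <= X](bigID (fun s : 'S_n => Rleb t (Ystat B s))) /=.
rewrite -[X in X <= _]Rplus_0_r; apply: Rplus_le_compat.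
  apply: Rsum_le => s; rewrite /Rleb; case: Rle_dec => // ht _.
  rewrite -exp_plus -exp_0; apply: exp_nondecreasing; nra.
elim/big_ind: _ => [|x y|s _]; [exact: Rle_refl | by move=> *; lra |].
by apply: Rmult_le_pos; apply/Rlt_le/exp_pos.
Qed.

(** * The norm of A and the doubly centred matrix *)

Lemma le_bigRmax (I : finType) (F : I -> R) (i : I) : F i <= \big[Rmax/0]_i F i.
Proof.
have : i \in index_enum I by exact: mem_index_enum.
elim: (index_enum I) => // j r IH.
rewrite in_cons big_cons => /orP[/eqP ->|/IH h].
  exact: Rmax_l.
exact: Rle_trans h (Rmax_r _ _).
Qed.

Lemma le_normA (n : nat) (A : 'I_n -> 'I_n -> R) (i j : 'I_n) :
  Rabs (A i j - row_avg A i) <= normA A.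
Proof.
apply: Rle_trans _
  (le_bigRmax _ (fun k => \big[Rmax/0]_j Rabs (A k j - row_avg A k)) i).
exact: (le_bigRmax _ (fun j => Rabs (A i j - row_avg A i))).
Qed.

(* W := Y - mu_A is the statistic of the doubly centred matrix, and swapping two
   values of the permutation changes it by at most 4 ||a||. *)
Definition dcenter {n : nat} (A : 'I_n -> 'I_n -> R) (i j : 'I_n) : R :=
  A i j - row_avg A i - col_avg A j + tot_avg A.

Section Centering.
Context (n : nat) (n1 : leq 1 n) (A : 'I_n -> 'I_n -> R).

Let nR : 0 < INR n. Proof. by apply/(lt_INR 0)/ltP. Qed.

Lemma sum_col_avg : \sum_j col_avg A j = INR n * tot_avg A.
Proof.
rewrite /col_avg /tot_avg /rsum -Rmult_sumr exchange_big.
by move: (bigop _ _ _) => x; field; lra.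
Qed.

Lemma sum_row_avg : \sum_i row_avg A i = INR n * tot_avg A.
Proof.
rewrite /row_avg /tot_avg /rsum -Rmult_sumr.
by move: (bigop _ _ _) => x; field; lra.
Qed.

Lemma sum_dcenter_row i : \sum_j dcenter A i j = 0.
Proof.
rewrite Rsum_add !Rsum_sub !Rsum_const card_ord sum_col_avg /row_avg /rsum.
by move: (bigop _ _ _) => x; field; lra.
Qed.

Lemma sum_dcenter_col j : \sum_i dcenter A i j = 0.
Proof.
rewrite Rsum_add !Rsum_sub !Rsum_const card_ord sum_row_avg /col_avg /rsum.
by move: (bigop _ _ _) => x; field; lra.
Qed.

Lemma Ystat_dcenter s : Ystat (dcenter A) s = Ystat A s - muA A.
Proof.
rewrite {1}/Ystat /rsum Rsum_add !Rsum_sub Rsum_const card_ord sum_row_avg.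
have -> : \sum_i col_avg A (s i) = INR n * tot_avg A.
  by rewrite -sum_col_avg [RHS](reindex_inj (@perm_inj _ s)).
have -> : \sum_i A i (s i) = Ystat A s by [].
by rewrite /muA; ring.
Qed.

(** Column and total averages cancel, leaving four signed entries [A x y - row_avg A x]. *)
Lemma swap_diff_dcenter_le i j k l :
  swap_diff (dcenter A) i j k l <= 4 * normA A.
Proof.
have B x y := Rle_trans _ _ _ (Rle_abs _) (le_normA n A x y).
have C x y := Rle_trans _ _ _ (Rle_abs _)
  (Rle_trans _ _ _ (Req_le _ _ (Rabs_Ropp _)) (le_normA n A x y)).
have := (B i l, B j k, C i k, C j l); rewrite /swap_diff /dcenter.
by case=> [[[h1 h2] h3] h4]; lra.
Qed.

End Centering.

(** * Passage to the opposite matrix for the lower tail *)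

Lemma rsum_opp (n : nat) (F : 'I_n -> R) : rsum (fun i => - F i) = - rsum F.
Proof. exact: Rsum_opp. Qed.

Section Negation.
Context (n : nat) (A : 'I_n -> 'I_n -> R).

Let NA i j := - A i j.

Lemma row_avgN i : row_avg NA i = - row_avg A i.
Proof. by rewrite /row_avg (rsum_opp _ (fun j => A i j)); ring. Qed.

Lemma col_avgN j : col_avg NA j = - col_avg A j.
Proof. by rewrite /col_avg (rsum_opp _ (fun i => A i j)); ring. Qed.

Lemma tot_avgN : tot_avg NA = - tot_avg A.
Proof.
rewrite /tot_avg.
rewrite [X in _ * X](_ : _ = - rsum (fun i => rsum (fun j => A i j))); first ring.
by rewrite -rsum_opp; apply: eq_bigr => i _; rewrite rsum_opp.
Qed.

Lemma sigma2AN : sigma2A NA = sigma2A A.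
Proof.
congr (_ * _); apply: eq_bigr => i _; apply: eq_bigr => j _.
by rewrite row_avgN col_avgN tot_avgN /NA; ring.
Qed.

Lemma cAN : cA NA = cA A.
Proof.
congr (_ * _); apply: eq_bigr => i _; apply: eq_bigr => j _.
by rewrite row_avgN -[RHS]Rabs_Ropp /NA; congr Rabs; ring.
Qed.

Lemma P_lowerN t : P_lower A t = P_upper NA t.
Proof.
rewrite /P_lower /P_upper /probS; congr (INR _ / _); apply: eq_card => s.
have YN : Ystat NA s = - Ystat A s by exact: rsum_opp.
rewrite !inE /muA tot_avgN YN /Rleb.
by case: Rle_dec => h1; case: Rle_dec => h2 //; exfalso; lra.
Qed.

End Negation.

(** * Exponential tail bound with a free parameter u *)

Lemma sigma2A_dcenter (n : nat) (A : 'I_n -> 'I_n -> R) :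
  sigma2A A = / (INR n - 1) * \sum_i \sum_j dcenter A i j ^ 2.
Proof. by []. Qed.

Lemma sum_sq_ge0 (I J : finType) (F : I -> J -> R) :
  0 <= \sum_i \sum_j F i j ^ 2.
Proof.
elim/big_ind: _ => [|x y|i _]; [exact: Rle_refl | by move=> *; lra |].
elim/big_ind: _ => [|x y|j _]; [exact: Rle_refl | by move=> *; lra |].
exact: pow2_ge_0.
Qed.

Section Tail.
Context (n : nat) (n2 : leq 2 n).

Let nR : 2 <= INR n. Proof. by apply/(le_INR 2)/leP. Qed.

Lemma sigma2A_ge0 (A : 'I_n -> 'I_n -> R) : 0 <= sigma2A A.
Proof.
rewrite sigma2A_dcenter; apply: Rmult_le_pos; last exact: sum_sq_ge0.
by apply/Rlt_le/Rinv_0_lt_compat; lra.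
Qed.

(** If c were not positive, every swap increment would be at most 0, and so would its negative,
    obtained by exchanging [i] and [j]. All increments then vanish, and [sum_swap_diff_sq] forces
    zero variance. *)
Lemma cA_gt0 (A : 'I_n -> 'I_n -> R) : sigma2A A <> 0 -> 0 < cA A.
Proof.
move=> sN0; rewrite /cA; apply: Rnot_le_lt => cle0; apply: sN0.
have sw0 i j k l : swap_diff (dcenter A) i j k l ^ 2 = 0.
  have := swap_diff_dcenter_le _ A i j k l.
  have := swap_diff_dcenter_le _ A j i k l.
  by rewrite /swap_diff => h1 h2; rewrite [X in X ^ 2](_ : _ = 0); [ring | lra].
have n1 : leq 1 n by exact: ltnW.
have := sum_swap_diff_sq _ _ (sum_dcenter_row _ n1 A) (sum_dcenter_col _ n1 A).
rewrite sigma2A_dcenter; move: (\sum_i \sum_j dcenter A i j ^ 2) => S.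
rewrite (eq_bigr (fun=> 0)) ?big1_eq; first last.
  move=> i _; rewrite (eq_bigr (fun=> 0)) ?big1_eq // => j _.
  rewrite (eq_bigr (fun=> 0)) ?big1_eq // => k _.
  by rewrite (eq_bigr (fun=> 0)) ?big1_eq // => l _.
by case/esym/Rmult_integral => [|->]; [nra | ring].
Qed.

Lemma P_upper_le (A : 'I_n -> 'I_n -> R) (t u : R) : sigma2A A <> 0 -> 0 <= u ->
  P_upper A t <= exp (- u * t + sigma2A A / cA A ^ 2 * phi (cA A * u)).
Proof.
move=> sN0 u0; have n1 : leq 1 n by exact: ltnW.
have c0 := cA_gt0 _ sN0.
have -> : P_upper A t = probS (fun s : 'S_n => Rleb t (Ystat (dcenter A) s)).
  by congr (INR _ / _); apply: eq_card => s; rewrite !inE Ystat_dcenter.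
apply: Rle_trans (probS_le _ _ t u u0) _.
rewrite exp_plus; apply: Rmult_le_compat_l; first exact/Rlt_le/exp_pos.
apply/Rle_div_l.
  by apply/(lt_INR 0)/ltP; rewrite cardsT; apply/card_gt0P; exists 1%g.
rewrite Rmult_comm; apply: mgfsum_le => // w w0.
have -> : cA A = 2 * (4 * normA A) by rewrite /cA; ring.
rewrite sigma2A_dcenter; apply: mgf_deriv_le => //.
- exact: sum_dcenter_row.
- exact: sum_dcenter_col.
- exact: swap_diff_dcenter_le.
Qed.

Lemma P_tail_le (A : 'I_n -> 'I_n -> R) (t u : R) : sigma2A A <> 0 -> 0 <= u ->
  P_tail A t <= exp (- u * t + sigma2A A / cA A ^ 2 * phi (cA A * u)).
Proof.
move=> sN0 u0; apply: Rmax_lub; first exact: P_upper_le.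
rewrite P_lowerN -[X in X / _ * _]sigma2AN -cAN; apply: P_upper_le => //.
by rewrite sigma2AN.
Qed.

End Tail.

(** * Rational bounds on [phi] and the choices of u *)

Lemma phi0 : phi 0 = 0.
Proof. by rewrite /phi exp_0; ring. Qed.

(** Both sides vanish at 0, and their derivatives are compared through (1 - y) e^y <= 1. *)
Lemma phi_le1 (x : R) : 0 <= x < 1 -> phi x <= x ^ 2 / (2 * (1 - x)).
Proof.
move=> [x0 x1]; pose f y := y ^ 2 / (2 * (1 - y)) - phi y.
have : f 0 <= f x.
  apply: (nondecreasing_from_0 f (fun y =>
    (2 * y - y ^ 2) / (2 * (1 - y) ^ 2) - y * exp y)) => // y [y0 yx].
    rewrite /f /phi; auto_derive; first lra.
    by field; lra.
  have h := exp_mul_one_sub_le y.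
  have -> : (2 * y - y ^ 2) / (2 * (1 - y) ^ 2) - y * exp y =
    y / (1 - y) ^ 2 * ((1 - y / 2) - (1 - y) * ((1 - y) * exp y)) by field; lra.
  apply: Rmult_le_pos; last nra.
  by apply: Rdiv_le_0_compat; nra.
have -> : f 0 = 0 by rewrite /f phi0; field.
by rewrite /f; lra.
Qed.

(** Comparing derivatives leaves (2 - y)^2 e^y <= 5 (4 - y) / 3. The exponential is removed by the
    fourth power of (1 - y/4) e^(y/4) <= 1. *)
Lemma phi_le2 (x : R) : 0 <= x < 2 -> phi x <= 5 * x ^ 2 / (3 * (2 - x)).
Proof.
move=> [x0 x2]; pose f y := 5 * y ^ 2 / (3 * (2 - y)) - phi y.
have : f 0 <= f x.
  apply: (nondecreasing_from_0 f (fun y =>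
    y / (2 - y) ^ 2 * (5 / 3 * (4 - y) - (2 - y) ^ 2 * exp y))) => // y [y0 yx].
    rewrite /f /phi; auto_derive; first lra.
    by field; lra.
  apply: Rmult_le_pos; first by apply: Rdiv_le_0_compat; nra.
  have h : (1 - y / 4) ^ 4 * exp y <= 1.
    have e4 : exp y = exp (y / 4) ^ 4.
      by rewrite /= Rmult_1_r -!exp_plus; congr exp; field.
    rewrite e4 -Rpow_mult_distr -[X in _ <= X](pow1 4); apply: pow_incr; split.
      by apply: Rmult_le_pos; [lra | exact/Rlt_le/exp_pos].
    exact: exp_mul_one_sub_le.
  have g : (2 - y) ^ 2 <= (1 - y / 4) ^ 4 * (5 / 3 * (4 - y)).
    have q : (2 - y) ^ 2 <= 4 * (1 - y / 4) ^ 4.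
      have q2 : 0 <= 2 - y <= 2 * (1 - y / 4) ^ 2 by nra.
      by have := pow_incr _ _ 2 q2; lra.
    (* At y = 8/5 the factor 5 (4 - y) / 3 drops to 4, the constant in [q]; beyond that point (2 -
       y)^2 is small enough for a crude bound. *)
    case: (Rle_dec y (8 / 5)) => hy.
      by apply: Rle_trans q _; rewrite Rmult_comm; apply: Rmult_le_compat_l;
        [nra | lra].
    have : (1 / 2) ^ 4 <= (1 - y / 4) ^ 4 by apply: pow_incr; lra.
    nra.
  have e0 := exp_pos y; nra.
have -> : f 0 = 0 by rewrite /f phi0; field.
by rewrite /f; lra.
Qed.

Theorem theorem3p1 (n : nat) (hn : leq 3 n) (A : 'I_n -> 'I_n -> R)
    (hsig : sigma2A A <> 0) :
  (forall t : R, 0 <= t ->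
     P_tail A t <= exp (- (t ^ 2 / (2 * (sigma2A A + cA A * t))))) /\
  (forall t : R, 0 <= t ->
     P_tail A t <= exp (- (t ^ 2 / (10 * sigma2A A / 3 + cA A * t)))) /\
  (forall t : R, exp 1 < t ->
     P_tail A t <= exp (- (t / cA A) * (ln t - ln (ln t) - sigma2A A / cA A)) /\
     exp (- (t / cA A) * (ln t - ln (ln t) - sigma2A A / cA A))
       <= exp (- (t / (2 * cA A)) * (ln t - 2 * sigma2A A / cA A))).
Proof.
have n2 : leq 2 n by exact: ltnW.
have c0 := cA_gt0 _ n2 _ hsig.
have v0 : 0 < sigma2A A.
  by case: (sigma2A_ge0 _ n2 A) => // /esym.
have tail t u := P_tail_le _ n2 A t u hsig.
move: (cA A) (sigma2A A) c0 v0 tail => c v c0 v0 tail {hsig}.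
have vc0 : 0 <= v / c ^ 2 by apply/Rlt_le/Rdiv_lt_0_compat; nra.
split; [|split] => t t0.
- have ct0 : 0 <= c * t by nra.
  (* Here 1 - cu = v / (v + ct), so the [phi_le1] term is exactly half of ut. *)
  have u0 : 0 <= t / (v + c * t) by apply: Rdiv_le_0_compat; lra.
  have cu1 : c * (t / (v + c * t)) < 1.
    by rewrite -Rmult_assoc; apply/Rlt_div_l; lra.
  apply: Rle_trans (tail t _ u0) _; apply: exp_nondecreasing.
  have := @phi_le1 (c * (t / (v + c * t))) ltac:(split; nra).
  move=> /(Rmult_le_compat_l _ _ _ vc0) h.
  apply: Rle_trans (Rplus_le_compat_l _ _ _ h) _; right.
  by field; lra.
- have ct0 : 0 <= c * t by nra.
  (* Here 2 - cu = (20 v / 3) / (10 v / 3 + ct), so the [phi_le2] term is again half of ut. *)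
  set u := 2 * t / (10 * v / 3 + c * t).
  have u0 : 0 <= u by apply: Rdiv_le_0_compat; lra.
  have cu2 : c * u < 2.
    by rewrite /u /Rdiv -Rmult_assoc; apply/Rlt_div_l; lra.
  apply: Rle_trans (tail t _ u0) _; apply: exp_nondecreasing.
  have := @phi_le2 (c * u) ltac:(split; nra).
  move=> /(Rmult_le_compat_l _ _ _ vc0) h.
  apply: Rle_trans (Rplus_le_compat_l _ _ _ h) _; right.
  by rewrite /u; field; lra.
have tpos : 0 < t by apply: Rlt_trans t0; exact: exp_pos.
have L1 : 1 < ln t.
  by rewrite -[1]ln_exp; apply: ln_increasing => //; exact: exp_pos.
have tE : exp (ln t) = t by exact: exp_ln.
set L := ln t in L1 tE *.
have lE : exp (ln L) = L by apply: exp_ln; lra.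
have l0 : 0 < ln L by rewrite -ln_1; apply: ln_increasing; lra.
set l := ln L in lE l0 *.
(* From e^(L/2) >= (1 + L/4)^2 = L + (1 - L/4)^2. This gives u >= 0 and also the last inequality of
   the theorem. *)
have lL : l <= L / 2.
  rewrite /l -[L / 2]ln_exp; apply: ln_le; first lra.
  have -> : L / 2 = L / 4 + L / 4 by field.
  rewrite exp_plus; have h := exp_ineq1_le (L / 4).
  have : (1 + L / 4) ^ 2 <= exp (L / 4) ^ 2 by apply: pow_incr; lra.
  by have := pow2_ge_0 (1 - L / 4); lra.
split.
  have u0 : 0 <= (L - l) / c by apply: Rdiv_le_0_compat; lra.
  apply: Rle_trans (tail t _ u0) _; apply: exp_nondecreasing.
  have -> : c * ((L - l) / c) = L - l by field; lra.
  (* Since e^(L - l) = t / L, the value is t - (t (1 + l) / L - 1), and t / L >= 1 with l > 0. *)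
  have ple : phi (L - l) <= t.
    rewrite /phi /Rminus exp_plus exp_Ropp tE lE.
    have tL : L <= t by rewrite -tE; have := exp_ineq1_le L; lra.
    have tL1 : 1 <= t / L by apply/Rle_div_r; lra.
    have -> : t * / L * (L + - l + -1) + 1 =
        t - (t / L * (1 + l) - 1) by field; lra.
    nra.
  have := Rmult_le_compat_l _ _ _ vc0 ple => h.
  apply: Rle_trans (Rplus_le_compat_l _ _ _ h) _; right.
  by field; lra.
apply: exp_nondecreasing.
have -> : - (t / (2 * c)) * (L - 2 * v / c) = - (t / c) * (L / 2 - v / c).
  by field; lra.
have tc : 0 < t / c by exact: Rdiv_lt_0_compat.
nra.
Qed.
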